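(* Let $S$ be a finite regular semigroup with zero $0$. Then an idempotent $e\in S$ is minimal if and only if it is primitive.
   Context: $S^1$ is $S$ with an identity adjoined if $S$ has none; $(a)=S^1aS^1$. A semigroup $T$ with zero is nilpotent if $T^m=\{0\}$ for some $m\in\mathbb{N}$. The radical is $R(S)=\{x\in S:(x)\text{ is a nilpotent semigroup}\}$, a two-sided ideal. In a finite semigroup Green's relations $\mathcal{D}$ and $\mathcal{J}$ coincide, and $\mathcal{D}$-classes are partially ordered by $\mathcal{D}_a\leq\mathcal{D}_b\Leftrightarrow(a)\subset(b)$. A non-zero $\mathcal{D}$-class $D$ is minimal if $D'\leq D$ implies $D'=D$ or $D'=\{0\}$. An idempotent of $S$ is minimal if it is contained in a minimal $\mathcal{D}$-class of the Rees quotient $S/R(S)$. The natural partial order on idempotents is $f\preceq e\Leftrightarrow ef=fe=f$; an idempotent $e$ is primitive if $e\neq 0$ and, for every idempotent $f\preceq e$, $f=e$ or $f=0$. *)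

(* Defs.v *)
From HB Require Import structures.
From mathcomp Require Import all_boot.
From mathcomp Require Import boolp classical_sets functions cardinality.

Set Implicit Arguments.
Unset Strict Implicit.
Unset Printing Implicit Defensive.

Local Open Scope classical_set_scope.
Local Open Scope group_scope.

HB.mixin Record Semigroup_hasZero S of Semigroup S := {
  szero : S;
  mul0s : left_zero szero (@mul S);
  muls0 : right_zero szero (@mul S)
}.

#[short(type="semigroup0Type")]
HB.structure Definition Semigroup0 := {S of Semigroup_hasZero S & Semigroup S}.

Bind Scope group_scope with Semigroup0.sort.

Notation "0" := (@szero _) : group_scope.

Section PrincipalIdeals.
Variable S : semigroupType.
Implicit Types (a b : S) (A B : set S).

Definition has_identity := exists u : S, forall x : S, u * x = x /\ x * u = x.

Definition adjoin_mul (x y : option S) : option S :=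
  match x, y with
  | None, _ => y
  | _, None => x
  | Some a, Some b => Some (a * b)
  end.

(* S^1 is realized inside [option S], where [None] is a formal identity which
   belongs to S^1 only when S has no identity of its own. *)
Definition S1 : set (option S) := [set o | o = None -> ~ has_identity].

Definition principal_left a : set S :=
  [set b | exists2 s, S1 s & Some b = adjoin_mul s (Some a)].

Definition principal_right a : set S :=
  [set b | exists2 t, S1 t & Some b = adjoin_mul (Some a) t].

Definition principal a : set S :=
  [set b | exists s t,
    [/\ S1 s, S1 t & Some b = adjoin_mul (adjoin_mul s (Some a)) t]].

Definition greenL a b := principal_left a = principal_left b.

Definition greenR a b := principal_right a = principal_right b.

Definition greenD a b := exists2 c, greenL a c & greenR c b.

Definition Dclass a : set S := [set b | greenD a b].

Definition is_Dclass (D : set S) := exists a, D = Dclass a.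

Definition Dclass_le (D D' : set S) :=
  exists a b, [/\ D = Dclass a, D' = Dclass b & principal a `<=` principal b].

Definition regular_semigroup := forall a, exists x, a * x * a = a.

Definition set_mul A B : set S := [set x * y | x in A & y in B].

(* [set_powS A n] is A^(n+1): the exponents start at 1. *)
Definition set_powS A n : set S := iter n (set_mul A) A.

Definition idempotent_elt (e : S) := e * e = e.

Definition idem_le (f e : S) := e * f = f /\ f * e = f.

Definition is_ideal (I : set S) :=
  I !=set0 /\ forall x s, I x -> I (s * x) /\ I (x * s).

End PrincipalIdeals.

Record ideal (S : semigroupType) := Ideal {
  ideal_set :> set S;
  idealP : is_ideal ideal_set
}.

Section ReesQuotient.
Variables (S : semigroupType) (I : ideal S).

(* [None] is the class of the elements of I. *)
Definition rees := option {x : S | x \notin (I : set S)}.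

Definition rees_proj (x : S) : rees := insub x.

Definition rees_mul (x y : rees) : rees :=
  match x, y with
  | Some a, Some b => rees_proj (val a * val b)
  | _, _ => None
  end.

HB.instance Definition _ := Choice.on rees.

Lemma rees_proj_ideal x : (I : set S) x -> rees_proj x = None.
Proof. by move=> Ix; rewrite /rees_proj insubN // negbK inE. Qed.

Lemma rees_projM x y : rees_mul (rees_proj x) (rees_proj y) = rees_proj (x * y).
Proof.
have [_ idl] := idealP I.
rewrite {1 2}/rees_proj; case: insubP => [u _ <-|] /=; last first.
  by rewrite negbK inE => /(idl _ y)[_ /rees_proj_ideal->].
case: insubP => [v _ <-|] //=.
by rewrite negbK inE => /(idl _ (val u))[/rees_proj_ideal->].
Qed.

Lemma rees_proj_surj (u : rees) : exists x, u = rees_proj x.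
Proof.
case: u => [u|]; first by exists (val u); rewrite /rees_proj valK.
by have [[x Ix] _] := idealP I; exists x; rewrite rees_proj_ideal.
Qed.

Lemma rees_mulA : associative rees_mul.
Proof.
move=> u v w; have [x ->] := rees_proj_surj u; have [y ->] := rees_proj_surj v.
by have [z ->] := rees_proj_surj w; rewrite !rees_projM mulgA.
Qed.

HB.instance Definition _ := isSemigroup.Build rees rees_mulA.

Lemma rees_mul0 : left_zero (None : rees) (@mul rees).
Proof. by []. Qed.

Lemma rees_mulr0 : right_zero (None : rees) (@mul rees).
Proof. by case. Qed.

HB.instance Definition _ :=
  Semigroup_hasZero.Build rees rees_mul0 rees_mulr0.

End ReesQuotient.

Section Radical.
Variable S : semigroup0Type.
Implicit Types (x e f : S) (T D : set S).

Definition nilpotent_semigroup T := exists n, set_powS T n = [set 0].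

Definition radical_set : set S := [set x | nilpotent_semigroup (principal x)].

Lemma mem_principal x : principal x x.
Proof.
case: (pselect (has_identity S)) => [[u uP]|no1].
  exists (Some u), (Some u); split=> //=.
  by rewrite (uP x).1 (uP x).2.
by exists None, None; split.
Qed.

Lemma S1_adjoin_mul (s t : option S) : S1 s -> S1 t -> S1 (adjoin_mul s t).
Proof. by case: s; case: t. Qed.

Lemma adjoin_mulA : associative (@adjoin_mul S).
Proof. by move=> [x|] [y|] [z|] //=; rewrite mulgA. Qed.

Lemma principalS x y : principal x y -> principal y `<=` principal x.
Proof.
move=> [s [t [Ss St ys]]] z [s' [t' [Ss' St' zs]]].
exists (adjoin_mul s' s), (adjoin_mul t t').
by split; [exact: S1_adjoin_mul | exact: S1_adjoin_mul |
  rewrite zs ys !adjoin_mulA].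
Qed.

Lemma principal0 x : principal x 0.
Proof. by exists (Some 0), (Some 0); split=> //=; rewrite muls0. Qed.

Lemma set_powS0 T n : T 0 -> set_powS T n 0.
Proof.
move=> T0; elim: n => //= n IHn.
by exists 0 => //; exists 0 => //; rewrite mul0s.
Qed.

Lemma set_powSS T T' n : T `<=` T' -> set_powS T n `<=` set_powS T' n.
Proof.
move=> sTT'; elim: n => //= n IHn _ [x Tx [y Ty <-]].
by exists x; [exact: sTT' | exists y; first exact: IHn].
Qed.

Lemma radical_is_ideal : is_ideal radical_set.
Proof.
have rad_sub x y : radical_set x -> principal x y -> radical_set y.
  move=> [n nilx] xy; exists n; apply/seteqP; split.
    by rewrite -nilx; apply: set_powSS; exact: principalS.
  by move=> _ ->; apply: set_powS0; exact: principal0.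
split.
  exists 0, 0%N; apply/seteqP; split=> [y|_ ->]; last exact: principal0.
  move=> [[s|] [[t|] [_ _ [->]]]] /=; rewrite ?muls0 ?mul0s //.
move=> x s radx; have [l [r [Sl Sr xE]]] := mem_principal x.
split; apply: rad_sub radx _.
  exists (adjoin_mul (Some s) l), r; split=> //; first exact: S1_adjoin_mul.
  by rewrite -!adjoin_mulA [adjoin_mul l _]adjoin_mulA -xE.
exists l, (adjoin_mul r (Some s)); split=> //; first exact: S1_adjoin_mul.
by rewrite adjoin_mulA -xE.
Qed.

Definition radical : ideal S := Ideal radical_is_ideal.

Definition minimal_Dclass D :=
  [/\ is_Dclass D, D <> [set 0] &
    forall D', is_Dclass D' -> Dclass_le D' D -> D' = D \/ D' = [set 0]].

Definition primitive e :=
  e <> 0 /\ forall f, idempotent_elt f -> idem_le f e -> f = e \/ f = 0.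

End Radical.

Definition minimal_idempotent (S : semigroup0Type) (e : S) :=
  exists D : set (rees (radical S)),
    minimal_Dclass D /\ D (rees_proj (radical S) e).

(* Main.v *)
Require Import Defs.
From mathcomp Require Import all_boot.
From mathcomp Require Import boolp classical_sets functions cardinality.

Local Open Scope classical_set_scope.

(** Regularity makes the radical trivial, so [S] is isomorphic to [S/R(S)] and
    minimality can be tested in [S] itself.  If [f] lies below [e] in the same
    D-class, then [e = s * f * t] and, by finiteness, [e] is fixed by right
    multiplication by a power of [f * t]; hence [f * e = e] and [f = e].
    Conversely, a non-zero [a] in [(e)] is R-related to an idempotent
    [h = s * e * t], and [e * t * h * s * e] is a non-zero idempotent below [e],
    hence equal to [e] when [e] is primitive, which makes [e] D-related to
    [a]. *)

(** As [g] commutes with [f] and undoes it at [x], [g^i] undoes [f^i] at [x]. The orbit of [x] under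
    [f] is eventually periodic, and applying [g^i] strips its preperiod. *)
Lemma iter_fixed_of_commuting_retraction (T : choiceType) (f g : T -> T) (x : T) :
  finite_set [set: T] -> (forall y, g (f y) = f (g y)) -> g (f x) = x ->
  exists k, iter k.+1 f x = x.
Proof.
move=> Tfin gf gfx.
have giter n : iter n g (iter n f x) = x.
  elim: n => // n IHn; rewrite iterSr iterS.
  suff -> : g (f (iter n f x)) = iter n f x by [].
  by elim: n {IHn} => //= n IHn; rewrite gf IHn.
have giterC i k y : iter i g (iter k f y) = iter k f (iter i g y).
  elim: i y => // i IHi y; rewrite !iterS IHi.
  by elim: k {IHi} => //= k <-; rewrite gf.
(* Pigeonhole: otherwise [n |-> iter n f x] embeds the naturals in a finite type. *)
have [i [k ik]] : exists i k, iter (k.+1 + i) f x = iter i f x.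
  apply: contrapT => noik; apply: infinite_nat.
  apply: (@sub_finite_set _ _ ((fun n => iter n f x) @^-1` [set: T])) => //.
  apply: finite_preimage => // m n _ _ /= mn.
  have [lt_mn|lt_nm|//] := ltngtP m n; exfalso; apply: noik.
    by exists m, (n - m.+1)%N; rewrite -subSn // subSS subnK // ltnW.
  by exists n, (m - n.+1)%N; rewrite -subSn // subSS subnK // ltnW.
by exists k; rewrite -[in RHS](giter i) -ik iterD giterC giter.
Qed.

(** * Green's relations in a regular semigroup *)

Section RegularGreen.
Local Open Scope group_scope.
Variables (S : semigroupType) (Sreg : regular_semigroup S).
Implicit Types a b c e f : S.

(** Regularity absorbs the adjoined identity: [a = (a * x) * a], so multipliers can be taken in [S].
    The next two lemmas use the same device. *)
Lemma principal_leftP a b : principal_left a b <-> exists s, b = s * a.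
Proof.
split=> [[[s|] _ [->]]|[s ->]]; first by exists s.
  by have [x ax] := Sreg a; exists (a * x).
by exists (Some s).
Qed.

Lemma principal_rightP a b : principal_right a b <-> exists t, b = a * t.
Proof.
split=> [[[t|] _ [->]]|[t ->]]; first by exists t.
  by have [x ax] := Sreg a; exists (x * a); rewrite mulgA.
by exists (Some t).
Qed.

Lemma principalP a b : principal a b <-> exists s t, b = s * a * t.
Proof.
have [x ax] := Sreg a.
split=> [[[s|] [[t|] [_ _ [->]]]]|[s [t ->]]]; first by exists s, t.
- by exists s, (x * a); rewrite -!mulgA [a * (x * a)]mulgA ax.
- by exists (a * x), t; rewrite ax.
- by exists (a * x), (x * a); rewrite ax mulgA.
- by exists (Some s), (Some t).
Qed.

Lemma greenLP a b :
  greenL a b <-> (exists s, a = s * b) /\ (exists s, b = s * a).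
Proof.
split=> [ab|[[s as_] [s' bs']]].
  split; apply/principal_leftP; [rewrite -ab|rewrite ab];
    apply/principal_leftP.
    by have [x ax] := Sreg a; exists (a * x).
  by have [x bx] := Sreg b; exists (b * x).
apply/seteqP; split=> c /principal_leftP[r ->]; apply/principal_leftP.
  by exists (r * s); rewrite -mulgA -as_.
by exists (r * s'); rewrite -mulgA -bs'.
Qed.

Lemma greenRP a b :
  greenR a b <-> (exists t, a = b * t) /\ (exists t, b = a * t).
Proof.
split=> [ab|[[t at_] [t' bt']]].
  split; apply/principal_rightP; [rewrite -ab|rewrite ab];
    apply/principal_rightP.
    by have [x ax] := Sreg a; exists (x * a); rewrite mulgA.
  by have [x bx] := Sreg b; exists (x * b); rewrite mulgA.
apply/seteqP; split=> c /principal_rightP[r ->]; apply/principal_rightP.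
  by exists (t * r); rewrite mulgA -at_.
by exists (t' * r); rewrite mulgA -bt'.
Qed.

Lemma greenD_refl a : greenD a a.
Proof. by exists a. Qed.

Lemma greenLR_comm a b c : greenL a c -> greenR c b ->
  exists2 d, greenR a d & greenL d b.
Proof.
move=> /greenLP[[s as_] [s' cs']] /greenRP[[t ct] [t' bt']].
(* Right translation by [t'] sends [c] to [b], hence [a] to the fourth corner of the egg-box. *)
exists (a * t').
  apply/greenRP; split; last by exists t'.
  by exists t; rewrite [in LHS]as_ ct bt' !mulgA -as_.
apply/greenLP; split.
  by exists s; rewrite as_ bt' mulgA.
by exists s'; rewrite mulgA -cs'.
Qed.

Lemma greenD_sym a b : greenD a b -> greenD b a.
Proof.
by move=> [c ac cb]; have [d ad db] := greenLR_comm _ _ _ ac cb; exists d.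
Qed.

Lemma greenD_trans b a c : greenD a b -> greenD b c -> greenD a c.
Proof.
(* The chain is a R x L b L y R c; swapping x L y R c into x R d L c leaves a R d L c. *)
move=> /greenD_sym[x bx xa] [y bc_L yc].
have [] := greenLR_comm x c y; first by rewrite /greenL -bx.
  exact: yc.
move=> d xd dc; apply: greenD_sym; exists d; first by rewrite /greenL.
by rewrite /greenR -xd.
Qed.

Lemma eq_Dclass a b : greenD a b -> Dclass a = Dclass b.
Proof.
move=> ab; apply/seteqP; split=> c; apply: greenD_trans => //.
exact: greenD_sym.
Qed.

Lemma principal_trans b a c : principal a b -> principal b c -> principal a c.
Proof.
move=> /principalP[s [t ->]] /principalP[s' [t' ->]]; apply/principalP.
by exists (s' * s), (t * t'); rewrite !mulgA.
Qed.

Lemma greenD_principal a b : greenD a b -> principal a b.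
Proof.
move=> [c /greenLP[_ [s ->]] /greenRP[_ [t ->]]]; apply/principalP.
by exists s, t.
Qed.

Lemma idem_le_principal_eq e f : finite_set [set: S] ->
  idempotent_elt f -> idem_le f e -> principal f e -> f = e.
Proof.
move=> Sfin ff [ef fe] /principalP[s [t est]].
(* Left multiplication by [s] undoes right multiplication by [f * t] at [e], since [e * f = f] and
   [e = s * f * t]. *)
have [|| k ek] := @iter_fixed_of_commuting_retraction S
    (fun y => y * (f * t)) (fun y => s * y) e Sfin.
- by move=> y; rewrite mulgA.
- by rewrite [e * _]mulgA ef [in RHS]est mulgA.
(* Because [e * f = f], the product [e * (f * t)^(k+1)], which is [e], begins with [f] and so is
   fixed by [f] on the left. *)
rewrite -fe -[in LHS]ek -[RHS]ek iterSr !mulgA ef.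
elim: k {ek} => [|k IHk] /=; first by rewrite mulgA ff.
by rewrite mulgA IHk.
Qed.

(** The link is [h * s * e]: multiplying by [e * t] on the left returns [e], and by [t] on the right
    returns [h * h = h]. *)
Lemma greenD_below_idempotent e h s t : h * h = h -> h = s * e * t ->
  e = e * t * h * s * e -> greenD e h.
Proof.
move=> hh hst eE; exists (h * s * e).
  apply/greenLP; split; last by exists (h * s).
  by exists (e * t); rewrite !mulgA.
apply/greenRP; split; first by exists (s * e); rewrite mulgA.
by exists t; rewrite -!mulgA [s * _]mulgA -hst.
Qed.

End RegularGreen.

(** * Minimal D-classes, primitive idempotents and the radical *)

Section MinimalPrimitive.
Local Open Scope group_scope.
Variables (S : semigroup0Type) (Sreg : regular_semigroup S).
Implicit Types a e : S.

Lemma principal_szero a : principal (0 : S) a -> a = 0.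
Proof. by move=> /(principalP _ Sreg)[s [t ->]]; rewrite muls0 mul0s. Qed.

Lemma Dclass_szero : Dclass (0 : S) = [set 0].
Proof.
apply/seteqP; split=> [a|_ ->]; last exact: greenD_refl.
by move=> /(greenD_principal _ Sreg)/principal_szero.
Qed.

Lemma primitive_of_minimal_Dclass e D : finite_set [set: S] ->
  minimal_Dclass D -> D e -> primitive e.
Proof.
move=> Sfin [[a ->] Dn0 Dmin] ae; split=> [e0|f ff fe].
  apply: Dn0; rewrite -Dclass_szero; congr Dclass; apply: principal_szero.
  by rewrite -e0; apply/greenD_principal/greenD_sym.
have ef : principal e f.
  by apply/principalP => //; exists f, f; case: fe => _ ->; rewrite ff.
(* The class of [f] lies below that of [a], as [f] is in [(e)] and [e] is D-related to [a]. If the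
   classes agree, [e] is in [(f)]. *)
have [||fa|f0] := Dmin (Dclass f); first by exists f.
- exists f, a; split=> //; apply: principalS.
  exact: principal_trans (greenD_principal _ Sreg _ _ ae) ef.
- left; apply: idem_le_principal_eq => //.
  apply: (principal_trans _ Sreg a); last exact: greenD_principal.
  apply: greenD_principal => //.
  have : Dclass a a by exact: greenD_refl.
  by rewrite -fa.
- by right; have : Dclass f f by [exact: greenD_refl]; rewrite f0.
Qed.

Lemma minimal_Dclass_of_primitive e :
  idempotent_elt e -> primitive e -> minimal_Dclass (Dclass e).
Proof.
move=> ee [en0 eprim]; split; first by exists e.
  by move=> e0; apply: en0; have : Dclass e e by [exact: greenD_refl]; rewrite e0.
move=> _ _ [a [b [-> eb ab]]].
have [->|an0] := pselect (a = 0); first by right; exact: Dclass_szero.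
left; apply/esym/eq_Dclass => //.
have /(principalP _ Sreg)[s [t aE]] : principal e a.
  apply: (principal_trans _ Sreg b); last exact/ab/mem_principal.
  by apply: greenD_principal => //; rewrite -[greenD _ _]/(Dclass e b) eb;
    exact: greenD_refl.
have [x axa] := Sreg a.
set h := a * x; set u := t * x.
have hh : h * h = h by rewrite /h mulgA axa.
have hE : h = s * e * u by rewrite /h aE /u !mulgA.
have ha : h * a = a by [].
have haR : greenR h a by apply/greenRP => //; split; [exists x | exists a].
clearbody h u; clear aE.
have hEr z : s * (e * (u * z)) = h * z by rewrite hE -!mulgA.
apply: (greenD_trans _ Sreg h).
  apply: (greenD_below_idempotent _ Sreg _ _ s u) => //.
  (* Since [s * e * u = h], both [f * f] and [s * f * u] collapse through powers of [h]: the first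
     gives idempotency, the second shows that [f = 0] would force [h = 0] and [a = h * a = 0]. *)
  set f := e * u * h * s * e.
  have ff : idempotent_elt f.
    rewrite /idempotent_elt /f -!mulgA [e * (e * _)]mulgA ee hEr.
    by rewrite [h * (h * (s * e))]mulgA hh [h * (h * _)]mulgA hh.
  have [|//|f0] := eprim f ff.
    by split; rewrite /f ?mulgA ?ee // -[LHS]mulgA ee.
  have hf : h = s * f * u.
    rewrite /f -!mulgA hEr [s * (e * u)]mulgA -hE.
    by rewrite [h * (h * _)]mulgA !hh.
  by exfalso; apply: an0; rewrite -ha hf f0 muls0 !mul0s.
by exists h.
Qed.

(** The idempotent [a * x] lies in every power of [(a)], so nilpotency kills it, and
    [a = (a * x) * a]. *)
Lemma radical_regular a : (radical S : set S) a -> a = 0.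
Proof.
move=> [n nila]; have [x axa] := Sreg a.
have hh : a * x * (a * x) = a * x by rewrite mulgA axa.
have pah : principal a (a * x).
  by apply/principalP => //; exists (a * x), x; rewrite axa.
suff h0 : a * x = 0 by rewrite -axa h0 mul0s.
have : set_powS (principal a) n (a * x).
  by elim: n {nila} => //= n IHn; exists (a * x) => //; exists (a * x).
by rewrite nila.
Qed.

Lemma rees_proj_radical_inj : injective (rees_proj (radical S)).
Proof.
move=> x y; rewrite /rees_proj.
case: insubP => [u _ <-|]; case: insubP => [v _ <-|] //=; first by case=> ->.
by rewrite !negbK !inE => /radical_regular -> /radical_regular ->.
Qed.

Lemma regular_rees (I : ideal S) : regular_semigroup (rees I).
Proof.
move=> u; have [a ->] := rees_proj_surj u; have [x axa] := Sreg a.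
exists (rees_proj I x).
by rewrite -[in RHS]axa -!rees_projM.
Qed.

End MinimalPrimitive.

(** * Transfer between [S] and its Rees quotient *)

Lemma primitive_iso (S T : semigroup0Type) (phi : S -> T) (e : S) :
  injective phi -> (forall u, exists x, u = phi x) ->
  (forall x y, phi (x * y)%g = (phi x * phi y)%g) -> phi 0%g = 0%g ->
  primitive (phi e) <-> primitive e.
Proof.
move=> phiI phiS phiM phi0; split=> -[en0 eprim]; split.
- by move=> e0; apply: en0; rewrite e0.
- move=> f ff [ef fe].
  have [||/phiI|] := eprim (phi f); rewrite /idempotent_elt /idem_le -?phiM.
  + by rewrite ff.
  + by rewrite ef fe.
  + by left.
  + by rewrite -phi0 => /phiI; right.
- by rewrite -phi0 => /phiI.
- move=> u; have [f ->] := phiS u.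
  rewrite /idempotent_elt /idem_le -!phiM => /phiI ff [/phiI ef /phiI fe].
  by have [//|->|->] := eprim f ff; [left|right].
Qed.

Theorem corollary4p8 (S : semigroup0Type) (Sfin : finite_set [set: S])
    (Sreg : regular_semigroup S) (e : S) (eidem : idempotent_elt e) :
  minimal_idempotent e <-> primitive e.
Proof.
pose Q := rees (radical S); pose pr : S -> Q := rees_proj (radical S).
have Qreg : regular_semigroup Q := regular_rees S Sreg (radical S).
have Qfin : finite_set [set: Q].
  apply: (@sub_finite_set _ _ (pr @` [set: S])); last exact: finite_image.
  by move=> u _; have [x ->] := rees_proj_surj u; exists x.
have prM (x y : S) : pr (x * y)%g = (pr x * pr y)%g by rewrite /pr -rees_projM.
(* Minimality of [e] is a statement about [Q], so primitivity is moved there and both directions are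
   proved in [Q]. *)
rewrite -(primitive_iso S Q pr) //.
- split=> [[D [Dmin De]]|eprim].
    exact: (primitive_of_minimal_Dclass Q Qreg _ _ Qfin Dmin De).
  exists (Dclass (pr e)); split; last exact: greenD_refl.
  by apply: minimal_Dclass_of_primitive => //; rewrite /idempotent_elt -prM eidem.
- exact: rees_proj_radical_inj.
- exact: rees_proj_surj.
(* A non-empty ideal contains zero, as [0 * x = 0]. *)
- by apply: rees_proj_ideal; case: (radical_is_ideal S) => [[x rx] /(_ x 0%g rx)];
    rewrite mul0s; case.
Qed.
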